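(* Let $k\ge 5$ be an integer. There exists an interval $I\subset[0,\infty)$ of positive length such that for any $t\in I$, $C_{\max}(G^k_{n,t})=\Theta(n)$ with high probability, i.e. for every $t\in I$ there is a constant $\alpha>0$ such that $\mathbb P\big(C_{\max}(G^k_{n,t})\ge \alpha n\big)\to 1$ as $n\to\infty$ (the upper bound $C_{\max}(G^k_{n,t})\le n$ being trivial).
   Context: Let $n,k$ be positive integers and let $E$ be the set of the $\binom n2$ unordered pairs of distinct elements of $\{1,\dots,n\}$. Let $(\Pi_e)_{e\in E}$ be independent Poisson point processes on $[0,\infty)$, each of intensity $\frac1n\,dt$. The forbidden-degree process $G^k_n=(G^k_{n,t})_{t\ge0}$ is the process of loopless multigraphs on the vertex set $\{1,\dots,n\}$ defined as follows: $G^k_{n,0}$ has no edge; at each time $t\in\Pi_e$ the multiplicity of the edge $e$ is increased by $1$ and then, for any endpoint $w$ of $e$ whose degree (counted with multiplicity) reaches $k$ at this step, all edges incident to $w$, including $e$, are removed (if both endpoints reach degree $k$ simultaneously, the removal takes place at both). Removed edges may be added again later. $C_{\max}(G)$ denotes the number of vertices of the largest connected component of $G$. *)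

(* Defs.v *)
From HB Require Import structures.
From mathcomp Require Import all_boot all_order all_algebra finmap.
From mathcomp Require Import all_classical all_reals all_analysis.
From mathcomp Require Import measurable_realfun.

Set Implicit Arguments.
Unset Strict Implicit.
Unset Printing Implicit Defensive.

Import Order.TTheory GRing.Theory Num.Theory.
Import numFieldNormedType.Exports.

Local Open Scope classical_set_scope.
Local Open Scope ring_scope.

(** * Loopless multigraphs on n vertices *)

Definition edge (n : nat) := {e : {set 'I_n} | #|e| == 2%N}.

(* A multigraph is the function giving the multiplicity of each edge. *)
Definition multigraph (n : nat) := {ffun edge n -> nat}.

Definition empty_graph (n : nat) : multigraph n := [ffun=> 0%N].

Definition degree (n : nat) (G : multigraph n) (w : 'I_n) : nat :=
  (\sum_(e : edge n | w \in val e) G e)%N.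

Definition adjacent (n : nat) (G : multigraph n) : rel 'I_n :=
  fun x y => [exists e : edge n, (0 < G e)%N && (val e == [set x; y]%SET)].

Definition Cmax (n : nat) (G : multigraph n) : nat :=
  (\max_(x : 'I_n) #|connect (adjacent G) x|)%N.

(** * The forbidden-degree process *)

Definition add_edge (n : nat) (G : multigraph n) (e : edge n) : multigraph n :=
  [ffun f => (G f + (f == e))%N].

(* Both endpoints are tested in the graph obtained right after the addition of
   e, so that the removal takes place at both when both reach degree k. *)
Definition fd_step (k n : nat) (G : multigraph n) (e : edge n) : multigraph n :=
  let G' := add_edge G e in
  [ffun f : edge n =>
    if [exists w : 'I_n, [&& w \in val e, w \in val f & degree G' w == k]]
    then 0%N else G' f].

(* Chronological order on pairs (time, edge). Almost surely no two edges ring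
   simultaneously; ties are broken by a fixed enumeration of the edges, so that
   the process is defined (and measurable) on the whole probability space. *)
Definition mark_le (R : realType) (n : nat) : rel (R * edge n) :=
  fun x y => (x.1 < y.1) || ((x.1 == y.1) && (enum_rank x.2 <= enum_rank y.2)%N).

(* Time 0 (almost surely not a point) is left out: the graph at time 0 is empty. *)
Definition marks (R : realType) (n : nat) (S : edge n -> set R) (t : R) :
    set (R * edge n) :=
  [set x | 0 < x.1 <= t /\ S x.2 x.1].

(* [marks S t] is finite when each S e is locally finite, as is required of
   point processes below; fset_set of an infinite set would be empty. *)
Definition fd_process (R : realType) (k n : nat) (S : edge n -> set R) (t : R) :
    multigraph n :=
  foldl (fun G x => fd_step k G x.2) (empty_graph n)
        (sort (@mark_le R n) (fset_set (marks S t))).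

(** * Independent Poisson point processes on [0, +oo[ *)

(* Testing the full product is enough since each F i is meant to be a
   sigma-algebra, hence contains setT. *)
Definition independent_sigma_algebras (R : realType) (d : measure_display)
    (T : measurableType d) (P : probability T R) (I : finType)
    (F : I -> set (set T)) : Prop :=
  forall A : I -> set T, (forall i, F i (A i)) ->
    P (\bigcap_i A i) = (\prod_(i : I) P (A i))%E.

Definition npoints (R : realType) (T : Type) (X : T -> set R) (A : set R)
    (w : T) : \bar R :=
  counting (X w `&` A).

Definition sigma_npoints (R : realType) (T : Type) (X : T -> set R)
    (A : set R) : set (set T) :=
  preimage_set_system setT (npoints X A) measurable.

Definition sigma_process (R : realType) (T : Type) (X : T -> set R) :
    set (set T) :=
  <<s \bigcup_(A in @measurable _ (measurableTypeR R)) sigma_npoints X A >>.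

(* Unlike the library's poisson_pmf, whose value at rate 0 is the constant 1,
   this is the Dirac mass at 0 when r = 0; the case is needed for null sets. *)
Definition poisson_weight (R : realType) (r : R) (m : nat) : R :=
  r ^+ m / m`!%:R * expR (- r).

Definition point_process (R : realType) (d : measure_display)
    (T : measurableType d) (X : T -> set R) : Prop :=
  [/\ forall w, X w `<=` `[0, +oo[,
      forall w (t : R), finite_set (X w `&` `[0, t]) &
      forall A : set (measurableTypeR R), measurable A ->
        measurable_fun setT (npoints X A)].

(* Homogeneous Poisson point process on [0, +oo[ with intensity lam * dt. *)
Definition poisson_point_process (R : realType) (d : measure_display)
    (T : measurableType d) (P : probability T R) (lam : R) (X : T -> set R) :
    Prop :=
  [/\ point_process X,
      forall A : set (measurableTypeR R), measurable A -> A `<=` `[0, +oo[ ->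
        (lebesgue_measure A < +oo)%E ->
        forall m : nat, P [set w | npoints X A w = (m%:R)%:E] =
          (poisson_weight (lam * fine (lebesgue_measure A)) m)%:E &
      forall (m : nat) (A : 'I_m -> set (measurableTypeR R)),
        (forall i, measurable (A i)) -> (forall i, A i `<=` `[0, +oo[) ->
        trivIset setT A ->
        independent_sigma_algebras P (fun i => sigma_npoints X (A i))].

Definition independent_poisson_processes (R : realType) (d : measure_display)
    (T : measurableType d) (P : probability T R) (I : finType) (lam : R)
    (X : I -> T -> set R) : Prop :=
  (forall i, poisson_point_process P lam (X i)) /\
  independent_sigma_algebras P (fun i => sigma_process (X i)).

(* Main.v *)
Require Import Defs.
From mathcomp Require Import all_boot all_order all_algebra.
From mathcomp Require Import zify ring lra.

(** The multiplicity [H e] of the points of [e] in [(0, t]] bounds that of [e]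
    in the process, with equality as soon as both endpoints have degree less
    than [k] in the multigraph [H]. Since [k >= 5], it is enough to find a giant
    component in the subgraph of [H] induced by the vertices of degree at most 4,
    where the multiplicities are independent Poisson variables of mean [t / n].

    Explore this subgraph one vertex at a time, keeping only the children of
    vertices with at most 3 children, all of them never seen before, and dropping
    every vertex that is hit twice. For [t] close to 2 the number of children has
    mean close to [10 exp(-2) > 1] as long as almost all vertices are unseen, so
    that after [c n] steps the set of active vertices has linear size, except on
    an event of exponentially small probability. Every active vertex is a child
    of an explored vertex of the current component that has at most 3 children,
    whence the size of this component is linear as well.

    The bounds come from two supermartingales, [(3/4)^|active|] (killed when too
    many vertices have been seen) and [2^(number of seen vertices)]. *)

Set Implicit Arguments.
Unset Strict Implicit.
Unset Printing Implicit Defensive.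

Import Order.TTheory GRing.Theory Num.Theory.

Local Open Scope ring_scope.

(** * Expectations over a finite product and deterministic exploration *)

Section ProductExpectation.
Variables (R : realFieldType) (E V : finType) (p : V -> R).
Implicit Types (f g : {ffun E -> V} -> R) (om : {ffun E -> V}).

Definition pweight om : R := \prod_e p (om e).

Definition expect f : R := \sum_om pweight om * f om.

Definition merge (F : pred E) om0 om : {ffun E -> V} :=
  [ffun e => if F e then om0 e else om e].

Hypothesis p_ge0 : forall v, 0 <= p v.
Hypothesis p_sum1 : \sum_v p v = 1.

Lemma pweight_ge0 om : 0 <= pweight om.
Proof. exact: prodr_ge0. Qed.

Lemma le_expect f g : (forall om, f om <= g om) -> expect f <= expect g.
Proof. by move=> fg; apply: ler_sum => om _; rewrite ler_wpM2l ?pweight_ge0. Qed.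

Lemma eq_expect f g : f =1 g -> expect f = expect g.
Proof. by move=> fg; apply: eq_bigr => om _; rewrite fg. Qed.

Lemma expectD f g : expect (fun om => f om + g om) = expect f + expect g.
Proof. by rewrite -big_split; apply: eq_bigr => om _; rewrite mulrDr. Qed.

Lemma expectZ a f : expect (fun om => a * f om) = a * expect f.
Proof. by rewrite mulr_sumr; apply: eq_bigr => om _; rewrite mulrCA. Qed.

Lemma expectB f g : expect (fun om => f om - g om) = expect f - expect g.
Proof. by rewrite -sumrB; apply: eq_bigr => om _; rewrite mulrBr. Qed.

Lemma expect_sum (I : finType) (A : pred I) (F : I -> {ffun E -> V} -> R) :
  expect (fun om => \sum_(i | A i) F i om) = \sum_(i | A i) expect (F i).
Proof.
by rewrite exchange_big; apply: eq_bigr => om _; rewrite mulr_sumr.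
Qed.

Lemma expect_prod (g : E -> V -> R) :
  expect (fun om => \prod_e g e (om e)) = \prod_e \sum_v p v * g e v.
Proof.
by rewrite bigA_distr_bigA; apply: eq_bigr => om _; rewrite -big_split.
Qed.

Lemma expect_cst a : expect (fun=> a) = a.
Proof.
rewrite (eq_expect (fun=> esym (mulr1 a))) expectZ.
have -> : expect (fun=> 1) = expect (fun om => \prod_e (fun _ _ => 1) e (om e)).
  by apply: eq_expect => om; rewrite big1.
rewrite (expect_prod (fun _ _ => 1)) big1 ?mulr1 // => e _.
by rewrite -[RHS]p_sum1; apply: eq_bigr => v _; rewrite mulr1.
Qed.

(* Exchanging the coordinates in [F] of two independent copies is a
   weight-preserving involution. *)
Lemma expect_merge (F : pred E) f :
  expect f = expect (fun om0 => expect (fun om => f (merge F om0 om))).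
Proof.
pose swap (x : {ffun E -> V} * {ffun E -> V}) := (merge F x.1 x.2, merge F x.2 x.1).
have swapK : involutive swap.
  by move=> [x y]; congr pair; apply/ffunP => e; rewrite !ffunE /=; case: (F e).
have expect2 (h : {ffun E -> V} -> {ffun E -> V} -> R) :
    expect (fun om0 => expect (h om0)) =
    \sum_x pweight x.1 * pweight x.2 * h x.1 x.2.
  rewrite -(pair_bigA _ (fun x y => pweight x * pweight y * h x y)) /=.
  apply: eq_bigr => x _; rewrite mulr_sumr.
  by apply: eq_bigr => y _; rewrite mulrA.
rewrite (expect2 (fun x y => f (merge F x y))).
rewrite (reindex_inj (can_inj swapK)) /=.
rewrite -[LHS](eq_expect (fun om => expect_cst (f om))) (expect2 (fun x _ => f x)).
apply: eq_bigr => -[x y] _ /=; congr (_ * f _).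
  rewrite /pweight -!big_split; apply: eq_bigr => e _ /=.
  by rewrite !ffunE; case: (F e); rewrite // mulrC.
by apply/ffunP => e; rewrite !ffunE; case: (F e).
Qed.

End ProductExpectation.

(** * Exploration of a fixed link function, vertex by vertex *)

(** [done] holds the processed vertices, [active] the discovered ones that wait, [fresh] those never
    hit, and [current] the accepted vertices of the component under exploration. A vertex in none of
    the first three sets has been dropped. *)
Record state n := State {
  done : {set 'I_n};
  active : {set 'I_n};
  fresh : {set 'I_n};
  current : {set 'I_n} }.

Section Exploration.
Variable n : nat.
Implicit Types (l : 'I_n -> 'I_n -> nat) (s : state n).

(** Active vertices have priority: a fresh one is taken only when the current component is
    exhausted, and it starts a new component. *)
Definition next s : option 'I_n :=
  if [pick x in active s] is Some x then Some x else [pick x in fresh s].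

Definition neighbours l s v : {set 'I_n} :=
  [set u | (u \notin done s) && (l v u != 0%N)].

(** The bound 3 leaves room for the link to the parent within the bound 4 of [sparse]. Since every
    neighbour must be fresh, a vertex that hits an active one has no children. *)
Definition accept l s v : bool :=
  [&& neighbours l s v \subset fresh s :\ v,
      [forall u in neighbours l s v, l v u == 1%N]
    & (#|neighbours l s v| <= 3)%N].

Definition children l s v : {set 'I_n} :=
  if accept l s v then neighbours l s v else set0.

(** All neighbours leave [active] and [fresh], and only accepted children come back. Thus a vertex
    hit twice, or found by a rejected vertex, is never processed. Processing a fresh vertex resets
    [current]. *)
Definition process l s v : state n :=
  State (v |: done s)
    (((active s :\ v) :\: neighbours l s v) :|: children l s v)
    ((fresh s :\ v) :\: neighbours l s v)
    ((if v \in active s then current s else set0) :|: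
     (if accept l s v then [set v] else set0)).

Definition step l s : state n := oapp (process l s) s (next s).

Definition explore l m s : state n := iter m (step l) s.

Definition initial : state n := State set0 set0 [set: 'I_n] set0.

(** The degree stays below every [k >= 5], and excluding multiple links makes counts truncated at 2
    exact around such a vertex. *)
Definition sparse l x := (\sum_u l x u <= 4)%N && [forall u, (l x u <= 1)%N].

Definition sparse_link l : rel 'I_n :=
  fun x y => [&& sparse l x, sparse l y & (0 < l x y)%N].

Record separated s : Prop := Separated {
  active_done : [disjoint active s & done s];
  fresh_done : [disjoint fresh s & done s];
  active_fresh : [disjoint active s & fresh s] }.

(** The invariant of the exploration. [fresh_link] and [active_deg] control the links back to
    [done], which [neighbours] ignores; they turn acceptance into a bound on the full degree. *)
Record explored l s : Prop := Explored {
  explored_separated :> separated s;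
  fresh_link : forall u w, u \in fresh s -> w \in done s -> l u w = 0%N;
  active_deg : forall a, a \in active s -> (\sum_(w in done s) l a w <= 1)%N;
  active_parent : forall a, a \in active s ->
    exists2 c, c \in current s & (0 < l c a)%N;
  current_done : {subset current s <= done s};
  current_deg : forall c, c \in current s -> sparse l c;
  current_connect : forall x y, x \in current s -> y \in current s ->
    connect (sparse_link l) x y;
  active_card : (#|active s| <= 3 * #|current s|)%N }.

Lemma separated_initial : separated initial.
Proof. by split=> /=; rewrite disjoints_subset ?sub0set // setC0. Qed.

Lemma explored_initial l : explored l initial.
Proof.
by split=> [|? ? _|?|?|?|?|?|] /=; rewrite ?cards0 ?inE //; exact: separated_initial.
Qed.

Lemma next_in s v : next s = Some v ->
  v \in active s \/ active s = set0 /\ v \in fresh s.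
Proof.
rewrite /next; case: pickP => [x xA [<-]|A0]; first by left.
case: pickP => // x xU [<-]; right; split=> //.
by apply/setP => y; rewrite inE; apply: A0.
Qed.

Lemma neighboursP l s v u : u \notin done s ->
  (u \in neighbours l s v) = (l v u != 0%N).
Proof. by move=> ud; rewrite inE ud. Qed.

Lemma children_sub l s v : children l s v \subset fresh s :\ v.
Proof. by rewrite /children; case: ifP => [/and3P[]|] //; rewrite sub0set. Qed.

Lemma separated_process l s v : separated s -> separated (process l s v).
Proof.
move=> ss; split=> /=.
- apply/pred0P => u /=; rewrite !inE.
  case: (eqVneq u v) => [->|uv] /=.
    rewrite andbF andbT; apply/negbTE/negP => /(subsetP (children_sub l s v)).
    by rewrite !inE eqxx.
  case: (boolP (u \in done s)); rewrite ?andbF // => ud.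
  rewrite andbT; apply/negbTE/norP; split.
    rewrite negb_and; apply/orP; right; apply: contraL ud => uA.
    by rewrite (disjointFr (active_done ss) uA).
  apply: contraL ud => /(subsetP (children_sub l s v)).
    by rewrite !inE => /andP[_ uU]; rewrite (disjointFr (fresh_done ss) uU).
- apply/pred0P => u /=; rewrite !inE.
  case: (eqVneq u v) => [->|uv] /=; first by rewrite andbF.
  case: (boolP (u \in fresh s)); rewrite ?andbF //= => /(disjointFr (fresh_done ss)) ->.
  by rewrite andbF.
- apply/pred0P => u /=; rewrite !inE.
  case: (eqVneq u v) => [->|uv] /=; first by rewrite !andbF.
  case: (boolP (u \in fresh s)); rewrite ?andbF //= => uU; rewrite andbT.
  rewrite (disjointFl (active_fresh ss) uU) /= andbF.
  case: (boolP (u \in children _ _ _)) => //=.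
  by rewrite /children; case: ifP; rewrite !inE // => _ ->.
Qed.

Lemma separated_step l s : separated s -> separated (step l s).
Proof.
by move=> ss; rewrite /step; case: (next s) => //= v; apply: separated_process.
Qed.

(** The only active vertices lost are [v] and those hit by [v], while the children come from [fresh]
    and are therefore new. *)
Lemma card_active_process l s v : separated s ->
  (#|active s| + #|children l s v| <=
   #|active (process l s v)| + #|neighbours l s v :&: active s|.+1)%N.
Proof.
move=> ss; set N := neighbours l s v; rewrite /= cardsU -/N.
have /disjoint_setI0 -> : [disjoint (active s :\ v) :\: N & children l s v].
  apply: disjointWl (subset_trans (subsetDl _ _) (subsetDl _ _)) _.
  apply: disjointWr (children_sub l s v) _.
  by apply: disjointWr (subsetDl _ _) (active_fresh ss).
rewrite cards0 subn0.
have : (#|active s| <= #|active s :\ v|.+1)%N.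
  by rewrite (cardsD1 v) -add1n leq_add2r leq_b1.
rewrite -(cardsID N (active s :\ v)).
have : (#|(active s :\ v) :&: N| <= #|N :&: active s|)%N.
  by rewrite setIC subset_leq_card // setIS // subsetDl.
move: #|_| #|_| #|_| #|_| #|_| => a b c d e.
lia.
Qed.

Section Process.
Variables (l : 'I_n -> 'I_n -> nat) (s : state n) (v : 'I_n).
Hypothesis lC : forall x y, l x y = l y x.
Hypothesis es : explored l s.
Hypothesis sv : next s = Some v.

Let v_done : v \notin done s.
Proof.
case: (next_in sv) => [vA|[_ vU]].
  by rewrite (disjointFr (active_done es) vA).
by rewrite (disjointFr (fresh_done es) vU).
Qed.

Let v_deg : (\sum_(w in done s) l v w <= (v \in active s))%N.
Proof.
case: (next_in sv) => [vA|[_ vU]]; first by rewrite vA active_deg.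
by rewrite big1 // => w wd; apply: (fresh_link es).
Qed.

(** At most 3 links go to vertices outside [done], and at most one, to the parent, goes to
    [done]. *)
Let accept_sparse : accept l s v -> sparse l v.
Proof.
case/and3P=> _ /forall_inP N1 N3; apply/andP; split; last first.
  apply/forallP => u; case: (boolP (u \in done s)) => [ud|ud].
    move: v_deg; rewrite (bigD1 u) //= => /(leq_trans (leq_addr _ _)) /leq_trans.
    by apply; apply: leq_b1.
  case: (boolP (u \in neighbours l s v)) => [/N1/eqP->//|].
  by rewrite neighboursP // negbK => /eqP ->.
apply: (@leq_trans (3 + (v \in active s))); last by case: (_ \in _).
rewrite (bigID [in done s]) /= addnC leq_add //.
apply: leq_trans N3; rewrite -sum1_card [leqRHS]big_mkcond [leqLHS]big_mkcond /=.
apply: leq_sum => u _; case: ifPn => // ud; case: ifPn => [/N1/eqP->//|].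
by rewrite neighboursP // negbK => /eqP ->.
Qed.

(** An accepted vertex adds at most 3 to [active] and exactly 1 to [current]. The reset of [current]
    is harmless because it happens only when [active] is empty. *)
Lemma card_active_process_le :
  (#|active (process l s v)| <= 3 * #|current (process l s v)|)%N.
Proof.
apply: leq_trans (leq_card_setU _ _) _ => /=.
have cN : (#|children l s v| <= 3 * accept l s v)%N.
  by rewrite /children; case: ifP => [/and3P[]//|_]; rewrite cards0.
have cA : (#|(active s :\ v) :\: neighbours l s v| <= #|active s|)%N.
  by rewrite subset_leq_card // (subset_trans (subsetDl _ _)) ?subsetDl.
apply: leq_trans (leq_add cA cN) _.
have -> : #|(if v \in active s then current s else set0) :|:
     (if accept l s v then [set v] else set0)| =
    ((if v \in active s then #|current s| else 0) + accept l s v)%N.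
  rewrite cardsU.
  have -> : (if v \in active s then current s else set0)
      :&: (if accept l s v then [set v] else set0) = set0.
    apply/setP => x; rewrite !inE; case: ifP; rewrite ?inE // => _.
    case: ifP; rewrite ?inE ?andbF // => _; apply/negP => /andP[xC /eqP xv].
    by move: v_done; rewrite -xv (current_done es xC).
  rewrite cards0 subn0; congr (_ + _)%N; first by case: ifP; rewrite ?cards0.
  by case: ifP; rewrite ?cards0 ?cards1.
rewrite mulnDr leq_add2r; case: ifP => [_|vA]; first exact: (active_card es).
by case: (next_in sv) => [|[-> _]]; rewrite ?vA ?cards0.
Qed.

Lemma explored_process : explored l (process l s v).
Proof.
have vchild u : u \in children l s v -> [&& u != v, u \in fresh s,
    u \notin done s, l v u == 1%N & accept l s v].
  move=> uc; have := subsetP (children_sub l s v) _ uc; rewrite !inE => /andP[-> uU].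
  rewrite uU (disjointFr (fresh_done es) uU) /=.
  move: uc; rewrite /children; case: ifP => [/and3P[_ /forall_inP h _] /h ->//|].
  by rewrite inE.
have Cdeg c : c \in current (process l s v) -> sparse l c.
  rewrite !inE => /orP[]; first by case: ifP => // _; [move/(current_deg es)|rewrite inE].
  by case: ifP; rewrite inE // => ac /eqP ->; apply: accept_sparse.
split=> //=.
- by apply: (separated_process l v); exact: es.
- move=> u w; rewrite !inE => /and3P[]; rewrite negb_and negbK => uN uv uU.
  case/orP => [/eqP ->|]; last exact: (fresh_link es).
  move: uN; rewrite (disjointFr (fresh_done es) uU) /= negbK => /eqP.
  by rewrite lC.
- move=> a; rewrite big_setU1 //= => /setUP[|/vchild /and5P[av aU ad /eqP la _]].
    rewrite !inE => /and3P[aN av aA].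
    rewrite lC; move: aN; rewrite (disjointFr (active_done es) aA) /= negbK => /eqP ->.
    exact: active_deg.
  by rewrite lC la big1 // => w wd; apply: (fresh_link es).
- move=> a /setUP[|/vchild /and5P[av aU ad /eqP la ac]]; last first.
    by exists v; rewrite ?la // ac !inE eqxx orbT.
  rewrite !inE => /and3P[aN av aA].
  have [c cC lca] := active_parent es aA; exists c => //.
  case: (next_in sv) => [vA|[A0]]; first by rewrite vA !inE cC.
  by rewrite A0 inE in aA.
- move=> c; rewrite !inE => /orP[|].
    case: ifP => [_ /(current_done es) ->|]; rewrite ?orbT ?inE //.
  by case: ifP; rewrite !inE // => _ ->.
(* An accepted active vertex joins the component through its parent. *)
- have vconn : v \in active s -> accept l s v ->
      exists2 c, c \in current s & sparse_link l v c && sparse_link l c v.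
    move=> vA ac; have [c cC lcv] := active_parent es vA; exists c => //.
    have dv : sparse l v by rewrite Cdeg // !inE ac inE eqxx orbT.
    have dc : sparse l c by apply: (current_deg es).
    by rewrite /sparse_link dv dc /= lC lcv.
  move=> x y; rewrite !inE.
  case: (boolP (v \in active s)) => vA; last first.
    rewrite inE; case: ifP; rewrite !inE //= => _ /eqP -> /eqP ->.
    exact: connect0.
  case: (boolP (accept l s v)) => ac; last by rewrite !inE !orbF; apply: (current_connect es).
  have [c cC /andP[vc cv]] := vconn vA ac; rewrite !inE.
  case/orP=> [xC|/eqP ->] /orP[yC|/eqP ->].
  + exact: (current_connect es).
  + exact: connect_trans (current_connect es xC cC) (connect1 cv).
  + exact: connect_trans (connect1 vc) (current_connect es cC yC).
  + exact: connect0.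
- exact: card_active_process_le.
Qed.

End Process.

Lemma explored_explore l m : (forall x y, l x y = l y x) ->
  explored l (explore l m initial).
Proof.
move=> lC; elim: m => [|m IHm]; first exact: explored_initial.
rewrite /explore iterS -/(explore l m initial) /step.
by case E: next => [v|] //=; apply: explored_process.
Qed.

End Exploration.

(** * The exploration of a random multigraph *)

Section Edges.
Variable n : nat.
Implicit Types (e : edge n) (v u : 'I_n).

Definition other_end v e : 'I_n := odflt v [pick u in val e :\ v].

Lemma other_endP v e : v \in val e ->
  other_end v e != v /\ val e = [set v; other_end v e].
Proof.
move=> ve; have c1 : #|val e :\ v| = 1%N.
  by have := cardsD1 v (val e); rewrite ve (eqP (valP e)) => -[].
have [u eu] : exists u, val e :\ v = [set u] by apply/cards1P/eqP.
rewrite /other_end; case: pickP => [w /=|/(_ u)]; last by rewrite eu inE eqxx.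
rewrite eu inE => /eqP ->; have : u \in val e :\ v by rewrite eu inE.
by rewrite !inE => /andP[uv _]; split; rewrite // -eu setD1K.
Qed.

Definition mkedge v u : option (edge n) := insub [set v; u].

Lemma mkedge_other v e : v \in val e -> mkedge v (other_end v e) = Some e.
Proof. by case/other_endP => _ ev; rewrite /mkedge -ev valK. Qed.

Lemma mkedgeP v u e : mkedge v u = Some e -> val e = [set v; u].
Proof. by rewrite /mkedge; case: insubP => // e' _ <- [->]. Qed.

Lemma mkedge_neq v u : v != u -> exists2 e, mkedge v u = Some e & val e = [set v; u].
Proof.
move=> vu; rewrite /mkedge; case: insubP => [e _ ee|]; first by exists e.
by rewrite cards2 vu.
Qed.

Lemma other_end_eq v u e : v != u -> val e = [set v; u] -> other_end v e = u.
Proof.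
move=> vu ee; have [|ov] := @other_endP v e; first by rewrite ee !inE eqxx.
move/setP/(_ u); rewrite ee !inE eqxx orbT [u == v]eq_sym (negbTE vu) /=.
by move/esym/eqP.
Qed.

(** The edges at [v] are in bijection with the vertices other than [v], through [other_end] and its
    partial inverse [mkedge]. *)
Lemma big_star (S : Type) (idx : S) (op : Monoid.com_law idx) v (G : 'I_n -> S) :
  \big[op/idx]_(e : edge n | v \in val e) G (other_end v e) =
  \big[op/idx]_(u | u != v) G u.
Proof.
rewrite (reindex_omap (other_end v) (mkedge v)) /=; last first.
  move=> u uv; have [|e -> ee] := @mkedge_neq v u; first by rewrite eq_sym.
  by rewrite /= (other_end_eq _ ee) // eq_sym.
apply: eq_bigl => e; apply/idP/andP => [ve|[uv /eqP/mkedgeP ->]].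
  by rewrite mkedge_other // eqxx; have [] := other_endP ve.
by rewrite !inE eqxx.
Qed.

Definition link (om : {ffun edge n -> 'I_3}) v u : nat :=
  if mkedge v u is Some e then om e else 0%N.

Lemma linkC om v u : link om v u = link om u v.
Proof. by rewrite /link /mkedge setUC. Qed.

Lemma link_other om v e : v \in val e -> link om v (other_end v e) = om e.
Proof. by move=> ve; rewrite /link mkedge_other. Qed.

End Edges.

(** * The exploration reads only links between unprocessed vertices *)

Section Locality.
Variable n : nat.
Implicit Types (l : 'I_n -> 'I_n -> nat) (s : state n).

Definition agree s l l' :=
  forall x y, x \notin done s -> y \notin done s -> l x y = l' x y.

Lemma eq_process s v l l' :
  (forall u, u \notin done s -> l v u = l' v u) -> process l s v = process l' s v.
Proof.
move=> ll; have N : neighbours l s v = neighbours l' s v.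
  by apply/setP => u; rewrite !inE; case: (boolP (u \in done s)) => // /ll ->.
have A : accept l s v = accept l' s v.
  rewrite /accept N; congr [&& _, _ & _]; apply: eq_forallb_in => u.
  by rewrite inE => /andP[/ll -> _].
by rewrite /process /children A N.
Qed.

Lemma next_done s v : separated s -> next s = Some v -> v \notin done s.
Proof.
move=> ss /next_in[vA|[_ vU]]; first by rewrite (disjointFr (active_done ss) vA).
by rewrite (disjointFr (fresh_done ss) vU).
Qed.

(** A step reads only the links from [v] to vertices outside [done], and [done] never shrinks, so
    agreement persists. *)
Lemma eq_explore s l l' m : separated s -> agree s l l' ->
  explore l m s = explore l' m s.
Proof.
elim: m s => // m IHm s ss ll; rewrite /explore !iterSr -!/(explore _ _ _).
have -> : step l' s = step l s.
  rewrite /step; case E: (next s) => [v|] //=; apply/esym/eq_process => u.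
  by apply: ll; apply: next_done E.
apply: IHm; first exact: separated_step.
rewrite /step; case: next => //= v x y; rewrite !inE !negb_or.
by move=> /andP[_ ?] /andP[_ ?]; apply: ll.
Qed.

End Locality.

Section RandomExploration.
Variables (R : realFieldType) (n : nat) (p : 'I_3 -> R).
Hypothesis p_ge0 : forall v, 0 <= p v.
Hypothesis p_sum1 : \sum_v p v = 1.
Implicit Types (om : {ffun edge n -> 'I_3}) (s : state n).

(** The Markov property behind the supermartingale bounds. The first step reads only edges at [v],
    and later steps read none of them, as [v] is then in [done]. By [expect_merge] these two groups
    of edges may be drawn from independent copies, and induction applies from the state after the
    first step. *)
Lemma expect_explore (Phi : state n -> R) (c : R) : 0 <= c ->
  (forall s, separated s ->
    expect p (fun om => Phi (step (link om) s)) <= c * Phi s) ->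
  forall m s, separated s ->
    expect p (fun om => Phi (explore (link om) m s)) <= c ^+ m * Phi s.
Proof.
move=> c0 PhiP; elim=> [|m IHm] s ss.
  by rewrite expr0 mul1r /explore /= expect_cst.
pose F e := if next s is Some v then v \in val (e : edge n) else false.
rewrite (expect_merge p_sum1 F).
apply: (@le_trans _ _
    (expect p (fun om0 => c ^+ m * Phi (step (link om0) s)))); last first.
  by rewrite expectZ exprSr -mulrA ler_wpM2l ?exprn_ge0 ?PhiP.
apply: le_expect => // om0; apply: le_trans (IHm _ (separated_step (link om0) ss)).
rewrite le_eqVlt; apply/orP; left; apply/eqP/eq_expect => om; congr Phi.
rewrite /explore iterSr -!/(explore _ _ _).
have -> : step (link (merge F om0 om)) s = step (link om0) s.
  rewrite /step; case E: (next s) => [v|] //=; apply: eq_process => u _.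
  rewrite /link; case E2: mkedge => [e|] //; rewrite ffunE /F E.
  by rewrite (mkedgeP E2) !inE eqxx.
apply: eq_explore; first exact: separated_step.
rewrite /step; case E: (next s) => [v|] /= x y; last first.
  by rewrite /link; case: mkedge => // e; rewrite ffunE /F E.
rewrite !inE !negb_or => /andP[xv _] /andP[yv _].
rewrite /link; case E2: mkedge => [e|] //; rewrite ffunE /F E (mkedgeP E2) !inE.
by rewrite ![v == _]eq_sym (negbTE xv) (negbTE yv).
Qed.

End RandomExploration.

(** * Generating functions of the numbers of neighbours and children in one step *)

Section OneStep.
Variables (R : realFieldType) (n : nat) (p : 'I_3 -> R).
Hypothesis p_ge0 : forall v, 0 <= p v.
Hypothesis p_sum1 : \sum_v p v = 1.
Implicit Types (om : {ffun edge n -> 'I_3}) (s : state n) (v : 'I_n).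

Lemma link_self om v : link om v v = 0%N.
Proof.
rewrite /link; case E: mkedge => [e|//]; have := valP e.
by rewrite (mkedgeP E) setUid cards1.
Qed.

(** The power of [y] is at most a product over the edges from [v] to [B], each equal to [y] with
    probability [1 - p ord0] and to 1 otherwise; independence factors the expectation. *)
Lemma expect_neighbours s v (B : {set 'I_n}) y : 1 <= y ->
  expect p (fun om => y ^+ #|neighbours (link om) s v :&: B|) <=
  (1 + (1 - p ord0) * (y - 1)) ^+ #|B|.
Proof.
move=> y1; have y0 : 0 <= y by apply: le_trans y1.
have p01 : p ord0 <= 1 by rewrite -p_sum1 (bigD1 ord0) //= lerDl sumr_ge0.
pose g (e : edge n) (w : 'I_3) : R :=
  if [&& v \in val e, other_end v e \in B & w != ord0] then y else 1.
apply: (@le_trans _ _ (expect p (fun om => \prod_e g e (om e)))).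
  apply: le_expect => // om; rewrite -prodr_const big_mkcond /=.
  rewrite (bigD1 v) //= !inE link_self eqxx andbF /= mul1r.
  rewrite -(big_star _ v (fun u => if u \in neighbours (link om) s v :&: B then y else 1)).
  rewrite big_mkcond /=; apply: ler_prod => e _; rewrite /g.
  case: (boolP (v \in val e)) => //= ve; last by rewrite ler01 lexx.
  rewrite !inE link_other //.
  case: (other_end v e \in B); rewrite ?andbF ?andbT /= ?ler01 ?lexx //.
  rewrite -[om e == ord0]/(nat_of_ord (om e) == 0%N).
  by case: (_ == _); case: (_ \in _); rewrite /= ?ler01 ?lexx ?y0 ?y1.
rewrite expect_prod.
under eq_bigr => e _.
  rewrite (_ : \sum_w _ = if v \in val e then
     (if other_end v e \in B then 1 + (1 - p ord0) * (y - 1) else 1) else 1).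
    over.
  rewrite /g; case: (v \in val e) => /=; last first.
    by under eq_bigr do rewrite mulr1.
  case: (other_end v e \in B) => /=; last by under eq_bigr do rewrite mulr1.
  rewrite (bigD1 ord0) //= mulr1.
  under eq_bigr => w /negbTE -> do rewrite /=.
  rewrite -mulr_suml.
  have -> : \sum_(i < 3 | i != ord0) p i = 1 - p ord0.
    by move: p_sum1; rewrite (bigD1 ord0) //= => <-; rewrite addrC addrK.
  ring.
rewrite -big_mkcond /= (big_star _ v (fun u => if u \in B then _ else 1)).
rewrite -big_mkcondr /= -prodr_const -/(is_true _).
have c1 : 1 <= 1 + (1 - p ord0) * (y - 1).
  by rewrite lerDl mulr_ge0 // subr_ge0.
rewrite big_mkcond [leRHS]big_mkcond /=; apply: ler_prod => u _.
case: (u \in B); rewrite ?andbF ?andbT ?ler01 ?lexx //.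
by case: ifP => _; rewrite ?ler01 ?lexx ?c1 ?(le_trans ler01 c1).
Qed.

(** For each set [J] of at most 3 fresh vertices, consider the event that [v] has simple links to
    [J] and no other link outside [done]. These events are disjoint, each makes [J] the set of
    children, and each has probability at least [x ^+ #|J| * p ord0 ^+ n]. The sum groups them by
    cardinality. *)
Lemma expect_children s v z x : separated s -> 0 <= z <= 1 -> 0 <= x ->
  p 1 = x * p ord0 -> p ord0 <= 1 ->
  \sum_(j < 4) (1 - z ^+ j) * ('C(#|fresh s :\ v|, j)%:R * x ^+ j * p ord0 ^+ n) <=
  1 - expect p (fun om => z ^+ #|children (link om) s v|).
Proof.
move=> ss /andP[z0 z1] x0 p1E p01.
pose P (J : {set 'I_n}) := (J \subset fresh s :\ v) && (#|J| <= 3)%N.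
pose g (J : {set _}) (e : edge n) (w : 'I_3) : R :=
  if (v \in val e) && (other_end v e \notin done s) then
    (w == if other_end v e \in J then 1 else ord0)%:R else 1.
pose row J om : R := \prod_e g J e (om e).
have Erow J : P J -> x ^+ #|J| * p ord0 ^+ n <= expect p (row J).
  move=> /andP[/subsetP JU _]; rewrite expect_prod.
  under eq_bigr => e _.
    rewrite (_ : \sum_w _ = if v \in val e then
      (if other_end v e \notin done s then
        (if other_end v e \in J then x * p ord0 else p ord0) else 1) else 1).
      over.
    rewrite /g; case: (v \in val e) => /=; last first.
      by under eq_bigr do rewrite mulr1.
    case: (other_end v e \in done s) => /=; first by under eq_bigr do rewrite mulr1.
    rewrite -p1E -[RHS](fun_if p).
    set w0 := if _ then _ else _; rewrite (bigD1 w0) //= eqxx mulr1 big1 ?addr0 //.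
    by move=> w /negbTE ->; rewrite mulr0.
  rewrite -big_mkcond /= (big_star _ v (fun u => if u \notin done s then
     (if u \in J then _ else _) else 1)).
  (* Vertices without a constraint contribute 1, at least [p ord0]; this gives the uniform exponent
     [n]. *)
  have -> : p ord0 ^+ n = \prod_(u < n) p ord0 by rewrite prodr_const card_ord.
  rewrite -prodr_const.
  rewrite big_mkcond [leRHS]big_mkcond -big_split /=.
  apply: ler_prod => u _; apply/andP; split.
    by rewrite mulr_ge0 //; case: ifP.
  case: (boolP (u \in J)) => [/JU|uJ].
    by rewrite !inE => /andP[-> /(disjointFr (fresh_done ss)) ->].
  by rewrite mul1r; do 2?case: ifP.
have lhsE : \sum_(j < 4) (1 - z ^+ j) *
      ('C(#|fresh s :\ v|, j)%:R * x ^+ j * p ord0 ^+ n) =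
    \sum_(J | P J) (1 - z ^+ #|J|) * (x ^+ #|J| * p ord0 ^+ n).
  rewrite [RHS](partition_big (fun J : {set 'I_n} => inord #|J| : 'I_4) xpredT) //=.
  apply: eq_bigr => j _; rewrite -cards_draws -sum1_card natr_sum.
  rewrite !mulr_suml mulr_sumr; apply: eq_big => [J|J]; last first.
    by rewrite inE => /andP[_ /eqP ->]; rewrite mul1r.
  rewrite inE /P; case: (_ \subset _) => //=; apply/idP/andP => [/eqP Jj|[J3 /eqP <-]].
    by rewrite Jj -ltnS ltn_ord; split=> //; apply/eqP/val_inj; rewrite /= inordK.
  by rewrite inordK.
rewrite lhsE.
have -> : 1 - expect p (fun om => z ^+ #|children (link om) s v|) =
    expect p (fun om => 1 - z ^+ #|children (link om) s v|).
  by rewrite expectB expect_cst.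
apply: (@le_trans _ _ (expect p (fun om => \sum_(J | P J) (1 - z ^+ #|J|) * row J om))).
  rewrite expect_sum; apply: ler_sum => J PJ; rewrite expectZ.
  by rewrite ler_wpM2l ?Erow // subr_ge0 exprn_ile1.
apply: le_expect => // om.
have zN j : 0 <= 1 - z ^+ j by rewrite subr_ge0 exprn_ile1.
set N := neighbours (link om) s v.
have rowP J : P J -> row J om != 0 ->
    (N = J) /\ (forall u, u \in J -> link om v u = 1%N).
  move=> /andP[/subsetP JU _] /prodf_neq0 h.
  have hu u : u \notin done s -> u != v -> link om v u = (u \in J).
    move=> ud uv; have [|e e_ ee] := @mkedge_neq n v u; first by rewrite eq_sym.
    have eu : other_end v e = u by rewrite (other_end_eq _ ee) // eq_sym.
    have ve : v \in val e by rewrite ee !inE eqxx.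
    rewrite -eu link_other // eu; move: (h e isT); rewrite /g ve eu ud /=.
    by case: (om e =P _) => [->|_]; rewrite ?eqxx //; case: ifP.
  have Jd u : u \in J -> [&& u \notin done s & u != v].
    move=> /JU; rewrite !inE => /andP[-> uU].
    by rewrite (disjointFr (fresh_done ss) uU).
  split=> [|u uJ]; last by have /andP[ud uv] := Jd _ uJ; rewrite hu // uJ.
  apply/setP => u; rewrite inE; case: (eqVneq u v) => [->|uv].
    by rewrite link_self andbF; apply/esym/negP => /Jd; rewrite eqxx andbF.
  case: (boolP (u \in done s)) => [ud|ud]; last by rewrite hu //; case: (u \in J).
  by apply/esym/negP => /Jd; rewrite ud.
have row01 J : 0 <= row J om <= 1.
  rewrite /row; apply/andP; split.
    by apply: prodr_ge0 => e _; rewrite /g; case: ifP.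
  apply: prodr_ile1 => e; rewrite /g.
  by case: ifP => _; rewrite ?ler01 ?lexx // ler0n lern1 leq_b1.
(* For a given [om], only the summand at [J = N] can be nonzero. *)
have term J : P J -> (1 - z ^+ #|J|) * row J om <=
    if J == N then 1 - z ^+ #|children (link om) s v| else 0.
  move=> PJ; have [->|rJ] := eqVneq (row J om) 0.
    by rewrite mulr0; case: ifP.
  have [NJ lJ] := rowP J PJ rJ; rewrite NJ eqxx.
  have -> : children (link om) s v = J.
    have /andP[JU J3] := PJ; rewrite /children /accept -/N NJ JU J3 andbT /=.
    by case: forall_inP => // -[] u /lJ ->.
  by rewrite ler_piMr //; case/andP: (row01 J).
apply: le_trans (ler_sum _ term) _; rewrite -big_mkcondr /=.
have [PN|PN] := boolP (P N).
  rewrite (big_pred1 N) // => J /=; case: eqP => [->|]; rewrite ?andbF //.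
  by rewrite andbT.
rewrite big_pred0 // => J; case: eqP => [->|_]; rewrite ?andbF //.
by rewrite andbT; apply/negbTE.
Qed.

End OneStep.

(** * Exponential bounds *)

(** When [a%:R * y < 1], this bounds [(1 + y) ^+ a] by the inverse of [1 - a%:R * y]. *)
Lemma bernoulli_inv (R : realFieldType) (a : nat) (y : R) :
  0 <= y -> (1 + y) ^+ a * (1 - a%:R * y) <= 1.
Proof.
move=> y0; elim: a => [|a IHa]; first by rewrite mul0r subr0 mulr1.
apply: le_trans IHa; rewrite exprSr -mulrA ler_wpM2l ?exprn_ge0 ?addr_ge0 //.
have : 0 <= a%:R * (y * y) by rewrite !mulr_ge0.
by rewrite -natr1; nra.
Qed.

(** Twenty steps of decay by [98 / 100] pay for one active vertex, of weight [3 / 4], and still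
    leave a factor [9 / 10]. *)
Lemma expr20_le (R : realFieldType) : (98 / 100) ^+ 20 <= 3 / 4 * (9 / 10) :> R.
Proof.
set w : R := 98 / 100; have w0 : 0 <= w by rewrite /w divr_ge0.
have square (a : nat) (b : R) : w ^+ a <= b -> w ^+ (a * 2) <= b * b.
  by move=> h; rewrite exprM expr2 ler_pM ?exprn_ge0.
have w5 : w ^+ 5 <= 9042 / 10000.
  have : w ^+ 4 * w <= 9226 / 10000 * w by rewrite ler_wpM2r // /w; lra.
  by rewrite -exprSr /w; lra.
apply: le_trans (square 10%N _ (square 5%N _ w5)) _; clear; lra.
Qed.

(** The hypotheses describe a Poisson law of mean [x = t / n] truncated at 2, with [t] just below 2:
    [p ord0] is [exp(-x)], its [n]-th power is [exp(-t)], and [(1 + x) ^+ n] is at most [exp(t)]. *)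
Section Supermartingales.
Variables (R : realFieldType) (n : nat) (p : 'I_3 -> R) (x : R).
Hypothesis p_ge0 : forall v, 0 <= p v.
Hypothesis p_sum1 : \sum_v p v = 1.
Hypothesis p1E : p 1 = x * p ord0.
Hypothesis p0x : 1 - x <= p ord0.
Hypothesis p0n : 13 / 100 <= p ord0 ^+ n.
Hypothesis xn2 : 199 / 100 <= n%:R * x <= 2.
Hypothesis x1n : (1 + x) ^+ n <= 9.
Hypothesis n_large : (1000 <= n)%N.
Implicit Types (om : {ffun edge n -> 'I_3}) (s : state n) (v : 'I_n).

Let p0_le1 : p ord0 <= 1.
Proof. by rewrite -p_sum1 (bigD1 ord0) //= lerDl sumr_ge0. Qed.

Let n0 : 0 < n%:R :> R.
Proof. by rewrite ltr0n; lia. Qed.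

Let x_ge0 : 0 <= x.
Proof. by move: p0x p0_le1; lra. Qed.

Definition many_fresh s := (199 * n <= 200 * #|fresh s|)%N.

(** Child sets of sizes 1, 2 and 3 contribute at least [13/100 * (c/4 + 7c^2/32 + 37c^3/384)] with
    [c = 197/100], which exceeds [27/100]. *)
Lemma expect_children_le s v : separated s -> many_fresh s ->
  expect p (fun om => (3 / 4) ^+ #|children (link om) s v|) <= 73 / 100.
Proof.
move=> ss big; have := @expect_children R n p p_ge0 p_sum1 s v (3 / 4) x ss.
have z01 : 0 <= (3 / 4 : R) <= 1 by lra.
move=> /(_ z01 x_ge0 p1E p0_le1); set a := #|fresh s :\ v|.
have : (198 * n <= 200 * a.-2)%N.
  have := cardsD1 v (fresh s); rewrite -/a; have := leq_b1 (v \in fresh s).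
  move: big n_large; rewrite /many_fresh; move: #|_| (nat_of_bool _) => f b.
  by clear -f b; lia.
have : (2 <= a)%N.
  have := cardsD1 v (fresh s); rewrite -/a; have := leq_b1 (v \in fresh s).
  move: big n_large; rewrite /many_fresh; move: #|_| (nat_of_bool _) => f b.
  by clear -f b; lia.
move: a => [|[|a]] //= _ an.
(* At this point [a] is the number of fresh vertices other than [v], minus 2. It is at least
   [99/100 * n], and [99/100 * 199/100] exceeds [197/100]. *)
set c : R := 197 / 100.
have ca : c <= a%:R * x.
  have : (198 * n)%:R * x <= (200 * a)%:R * x by rewrite ler_wpM2r // ler_nat.
  by rewrite !natrM /c; move: xn2; lra.
have ca1 : c <= a.+1%:R * x by apply: le_trans ca _; rewrite ler_wpM2r // ler_nat.
have ca2 : c <= a.+2%:R * x by apply: le_trans ca1 _; rewrite ler_wpM2r // ler_nat.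
have c0 : 0 <= c by rewrite /c; lra.
have b2 : 'C(a.+2, 2)%:R * x ^+ 2 = (a.+2%:R * x) * (a.+1%:R * x) / 2.
  have : ('C(a.+2, 2) * 2 = a.+2 * a.+1)%N 
    by rewrite -[2%N]/(2`!) bin_ffact !ffactnS ffactn0 /= muln1.
  move/(congr1 (fun k => k%:R : R)); rewrite !natrM => h.
  by rewrite (_ : _ * _ = 'C(a.+2, 2)%:R * 2 * x ^+ 2 / 2); [rewrite h|]; field.
have b3 : 'C(a.+2, 3)%:R * x ^+ 3 = (a.+2%:R * x) * (a.+1%:R * x) * (a%:R * x) / 6.
  have : ('C(a.+2, 3) * 6 = a.+2 * a.+1 * a)%N.
    by rewrite -[6%N]/(3`!) bin_ffact !ffactnS ffactn0 /= muln1 !mulnA.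
  move/(congr1 (fun k => k%:R : R)); rewrite !natrM => h.
  by rewrite (_ : _ * _ = 'C(a.+2, 3)%:R * 6 * x ^+ 3 / 6); [rewrite h|]; field.
rewrite !big_ord_recl big_ord0 /= -[bump 0 0]/1%N -[bump 0 1]/2%N -[bump 0 2]/3%N b2 b3 bin1.
have h2 : c * c <= (a.+2%:R * x) * (a.+1%:R * x) by apply: ler_pM.
have h3 : c * c * c <= (a.+2%:R * x) * (a.+1%:R * x) * (a%:R * x).
  by apply: ler_pM => //; apply: mulr_ge0.
move: h2 h3 ca2 p0n; rewrite expr0 !expr1.
move: (p ord0 ^+ n) (_ * _ * (a%:R * x)) => P0 T3.
move: (a.+2%:R * x * (a.+1%:R * x)) => T2; move: (a.+2%:R * x) => T1 h2 h3 h1 hP.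
have q0 : 0 <= 13 / 100 :> R by lra.
have k1 : 13 / 100 * c <= P0 * T1 by exact: ler_pM.
have k2 : 13 / 100 * (c * c) <= P0 * T2 by apply: ler_pM; rewrite // mulr_ge0.
have k3 : 13 / 100 * (c * c * c) <= P0 * T3.
  by apply: ler_pM; rewrite // mulr_ge0 // mulr_ge0.
move: k1 k2 k3; rewrite /c; move: (expect _ _) => EE; lra.
Qed.

Definition Phi1 s : R := if many_fresh s then (3 / 4) ^+ #|active s| else 0.

(* [98 / 100 = 4 / 3 * (73 / 100 + 1 / 200)], where [1 / 200] bounds the
   contribution of the active vertices that are hit a second time. *)
Lemma expect_Phi1 s : separated s ->
  expect p (fun om => Phi1 (step (link om) s)) <= 98 / 100 * Phi1 s.
Proof.
move=> ss; have [big|nbig] := boolP (many_fresh s); last first.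
  rewrite [Phi1 s]/Phi1 (negbTE nbig) mulr0.
  apply: sumr_le0 => om _; apply: mulr_ge0_le0; first exact: pweight_ge0.
  (* The set [fresh] only shrinks, so a killed value remains 0. *)
  rewrite /Phi1 ifN //; apply: contra nbig => /leq_trans; apply; rewrite leq_mul2l /=.
  rewrite /step; case: next => //= v.
  by rewrite subset_leq_card // (subset_trans (subsetDl _ _)) ?subsetDl.
case E: (next s) => [v|]; last first.
  move: E; rewrite /next; case: pickP => // _; case: pickP => // F0 _.
  move: big; by rewrite /many_fresh (eq_card0 F0); move: n_large; clear -n; lia.
rewrite [X in _ <= _ * X]/Phi1 big.
have [y yE] : exists y : R, y = 4 / 3 by exists (4 / 3).
have [z zE] : exists z : R, z = 3 / 4 by exists (3 / 4).
rewrite -zE; have zy : z * y = 1 by rewrite zE yE; field.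
have [z0 z1 y0 y1] : [/\ 0 <= z, z <= 1, 0 <= y & 1 <= y].
  by rewrite zE yE; split; lra.
pose lost om := #|neighbours (link om) s v :&: active s|.
pose born om := #|children (link om) s v|.
apply: (@le_trans _ _ (expect p (fun om =>
    z ^+ #|active s| * y * (z ^+ born om + (y ^+ lost om - 1))))).
  apply: le_expect => // om; rewrite /step E /=.
  apply: (@le_trans _ _ (z ^+ #|active (process (link om) s v)|)).
    by rewrite /Phi1 -zE; case: ifP => // _; apply: exprn_ge0.
  have := card_active_process (link om) v ss; rewrite -/(born om) -/(lost om) => cA.
  apply: (@le_trans _ _ (z ^+ (#|active s| + born om) * y ^+ (lost om).+1)).
    apply: (@le_trans _ _ (z ^+ (#|active (process (link om) s v)| + (lost om).+1)
        * y ^+ (lost om).+1)).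
      by rewrite exprD -mulrA -exprMn zy expr1n mulr1.
    by rewrite ler_wpM2r ?exprn_ge0 // ler_wiXn2l.
  rewrite exprD exprS -!mulrA ler_wpM2l ?exprn_ge0 // mulrCA ler_wpM2l //.
  (* Either [v] is accepted and [lost] is 0, or it is rejected and [born] is 0; in both cases the
     product of the two powers is their sum minus 1. *)
  rewrite /born /lost /children; case: ifP => [/and3P[Nf _ _]|_].
    rewrite (_ : _ :&: _ = set0) ?cards0 ?expr0 ?subrr ?addr0 ?mulr1 //.
    apply: disjoint_setI0; apply: disjointWl Nf _.
    by rewrite disjoint_sym; apply: disjointWr (subsetDl _ _) (active_fresh ss).
  by rewrite cards0 expr0 mul1r addrC subrK.
rewrite expectZ expectD expectB expect_cst //.
rewrite [leRHS]mulrC -mulrA ler_wpM2l ?exprn_ge0 //.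
have h1 := expect_children_le v ss big.
(* There are at most [n / 200] active vertices, each hit with probability at most [x], and
   [y - 1 = 1/3]; so [a * x / 3 <= 1 / 300], and [bernoulli_inv] gives [300 / 299]. *)
have h2 : expect p (fun om => y ^+ lost om) <= 300 / 299.
  apply: le_trans (expect_neighbours p_ge0 p_sum1 s v (active s) y1) _.
  set a := #|active s|; have ab : (200 * a <= n)%N.
    have := max_card [in active s :|: fresh s].
    rewrite card_ord cardsU (disjoint_setI0 (active_fresh ss)) cards0 subn0.
    by move: big; rewrite /many_fresh /a; move: #|_| #|_| => f b; clear -f b; lia.
  have x3 : 0 <= x / 3 by rewrite divr_ge0.
  have := bernoulli_inv a x3.
  have : (1 + (1 - p ord0) * (y - 1)) ^+ a <= (1 + x / 3) ^+ a.
    by rewrite lerXn2r ?nnegrE ?yE //; move: p0x p0_le1 x_ge0; lra.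
  have : (200 * a)%:R * x <= n%:R * x by rewrite ler_wpM2r // ler_nat.
  have : 0 <= (1 + x / 3) ^+ a by rewrite exprn_ge0 //; lra.
  rewrite natrM; move: ((1 + x / 3) ^+ a) (_ ^+ a) => U W U0 ax WU UB.
  have : a%:R * (x / 3) <= 1 / 300 by move: xn2; lra.
  by move: (a%:R * _) UB => b UB hb; nra.
move: h1 h2; rewrite -zE yE; move: (expect _ _) (expect _ _) => e1 e2; lra.
Qed.

Definition Phi2 s : R := 2 ^+ (n - #|fresh s|).

(** A step newly sees at most [v] and its neighbours: the factor is 2 for [v] and at most 9 on
    average for the neighbours. *)
Lemma expect_Phi2 s : separated s ->
  expect p (fun om => Phi2 (step (link om) s)) <= 18 * Phi2 s.
Proof.
move=> ss; have P0 : 0 <= Phi2 s by apply: exprn_ge0.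
case E: (next s) => [v|]; last first.
  have -> : expect p (fun om => Phi2 (step (link om) s)) = Phi2 s.
    by rewrite /step E /= expect_cst.
  by move: (Phi2 s) P0 => P P0; lra.
have := expect_neighbours p_ge0 p_sum1 s v [set: 'I_n] (ler1n _ 2).
rewrite cardsT card_ord => h.
have {}h : expect p (fun om => 2 ^+ #|neighbours (link om) s v :&: [set: 'I_n]|) <= 9.
  apply: le_trans h _; apply: le_trans x1n.
  rewrite lerXn2r ?nnegrE //; [| |]; move: p0x p0_le1 x_ge0; lra.
apply: (@le_trans _ _ (2 * Phi2 s * expect p (fun om =>
  2 ^+ #|neighbours (link om) s v :&: [set: 'I_n]|))); last first.
  by move: (expect _ _) h => e h; nra.
rewrite -expectZ; apply: le_expect => // om; rewrite /step E /= setIT.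
rewrite /Phi2 /= -exprS -exprD ler_weXn2l ?ler1n //.
set N := neighbours _ _ _.
have : (#|fresh s| <= #|fresh s :\ v|.+1)%N.
  by rewrite (cardsD1 v) -add1n leq_add2r leq_b1.
rewrite -(cardsID N (fresh s :\ v)).
have : (#|(fresh s :\ v) :&: N| <= #|N|)%N by rewrite subset_leq_card // subsetIr.
move: #|_| #|_| #|_| #|_| => a b c d; clear -a b c d; lia.
Qed.

(** If [current] is small, then at most [q] vertices are active. Either many vertices are still
    fresh and [Phi1] is at least [(3/4)^q], or at least [n / 200 >= 100 * q] have been seen and
    [Phi2] is at least [2^(100 q)]. Markov's inequality treats both cases. *)
Lemma expect_small_exploration q : (1000 * (20 * q) <= n)%N ->
  expect p (fun om =>
    (3 * #|current (explore (link om) (20 * q) (initial n))| <= q)%:R) <=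
  2 * (9 / 10) ^+ q.
Proof.
move=> qn; pose z : R := 3 / 4; have z0 : 0 < z by rewrite /z; lra.
have s0 := separated_initial n.
have k1 : 0 <= 98 / 100 :> R by lra.
have k2 : 0 <= 18 :> R by lra.
have := expect_explore p_ge0 p_sum1 k2 expect_Phi2 (20 * q) s0.
have := expect_explore p_ge0 p_sum1 k1 expect_Phi1 (20 * q) s0.
rewrite /Phi1 /Phi2 {2}/many_fresh /= cardsT card_ord leq_mul2r orbT subnn cards0 !mulr1.
set E1 := expect _ _; set E2 := expect _ _ => h1 h2.
apply: (@le_trans _ _ (z ^- q * E1 + 2 ^- (100 * q) * E2)).
  rewrite -!expectZ -expectD; apply: le_expect => // om.
  have es := explored_explore (20 * q) (linkC om); set s := explore _ _ _ in es *.
  have := active_card es; case: (leqP _ q) => [cq|_ _]; last first.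
    by case: ifP => _; rewrite ?mulr0 addr_ge0 ?mulr_ge0 ?invr_ge0 ?exprn_ge0 //; lra.
  move=> /leq_trans/(_ cq) Aq; case: ifP => [_|/negbT nbig].
    rewrite -[leLHS]addr0 lerD ?mulr_ge0 ?invr_ge0 ?exprn_ge0 //.
    by rewrite ler_pdivlMl ?exprn_gt0 // mulr1 ler_wiXn2l // /z; lra.
  rewrite mulr0 add0r ler_pdivlMl ?exprn_gt0 // mulr1 ler_weXn2l ?ler1n //.
  by move: nbig qn; rewrite /many_fresh; move: #|_| => f; clear -f; lia.
have -> : 2 * (9 / 10) ^+ q = (9 / 10) ^+ q + (9 / 10) ^+ q :> R by ring.
apply: lerD.
  rewrite ler_pdivrMl ?exprn_gt0 // -exprMn; apply: le_trans h1 _.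
  rewrite exprM lerXn2r ?nnegrE ?exprn_ge0 ?mulr_ge0 ?invr_ge0 //.
  exact: expr20_le.
rewrite ler_pdivrMl ?exprn_gt0 //; apply: le_trans h2 _.
rewrite !exprM -exprMn lerXn2r ?nnegrE ?mulr_ge0 ?exprn_ge0 //; first lra.
(* As [2^100 = 32^20], the ratio is [(18/32)^20] for each unit of [q]. *)
rewrite -[100%N]/(5 * 20)%N exprM.
have -> : 2 ^+ 5 = 32 :> R by ring.
rewrite -ler_pdivrMl ?exprn_gt0 // -exprVn -exprMn.
apply: (@le_trans _ _ ((9 / 10) ^+ 20)).
  by rewrite lerXn2r ?nnegrE //; lra.
by rewrite -[leRHS]expr1 ler_wiXn2l //; lra.
Qed.

End Supermartingales.

From mathcomp Require Import finmap.
From mathcomp Require Import all_classical all_reals all_analysis.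
From mathcomp Require Import measurable_realfun.

Import Order.TTheory GRing.Theory Num.Theory.
Import numFieldNormedType.Exports.

Local Open Scope classical_set_scope.
Local Open Scope ring_scope.

(** * Comparison with the multigraph of all points *)

Section DegreeComparison.
Variables (k n : nat).
Implicit Types (L : seq (edge n)) (e : edge n) (w : 'I_n).

Definition count_graph L : multigraph n := [ffun e => count_mem e L].

Definition run L : multigraph n := foldl (@fd_step k n) (empty_graph n) L.

Lemma run_le_count L e : (run L e <= count_graph L e)%N.
Proof.
rewrite ffunE; elim/last_ind: L => [|L f IHL]; first by rewrite ffunE.
rewrite /run foldl_rcons -/(run L) -cats1 count_cat /= addn0 ffunE eq_sym.
by case: ifP => // _; rewrite ffunE leq_add2r.
Qed.

(** Degrees in the process never exceed the final degrees in [count_graph L], so no endpoint of [e]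
    ever reaches [k] and [e] is never removed. *)
Lemma run_eq_count L e :
  (forall w, w \in val e -> degree (count_graph L) w < k)%N ->
  run L e = count_graph L e.
Proof.
rewrite ffunE; elim/last_ind: L => [_|L f IHL Lk]; first by rewrite ffunE.
have le_deg w : (degree (add_edge (run L) f) w <= degree (count_graph (rcons L f)) w)%N.
  apply: leq_sum => g _; rewrite !ffunE -cats1 count_cat /= addn0 [f == g]eq_sym.
  by rewrite leq_add2r; have := run_le_count L g; rewrite ffunE.
rewrite /run foldl_rcons -/(run L) -cats1 count_cat /= addn0 ffunE.
case: existsP => [[w /and3P[_ we /eqP wk]]|_].
  by have := leq_ltn_trans (le_deg w) (Lk w we); rewrite wk ltnn.
rewrite ffunE [f == e]eq_sym IHL // => w we; apply: leq_ltn_trans (Lk w we).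
by apply: leq_sum => g _; rewrite !ffunE -cats1 count_cat leq_addr.
Qed.

(* The value 2 stands for every multiplicity larger than 1. *)
Definition truncation L : {ffun edge n -> 'I_3} := [ffun e => inord (minn (count_mem e L) 2)].

Lemma val_truncation L e : truncation L e = minn (count_mem e L) 2 :> nat.
Proof. by rewrite ffunE inordK // ltnS geq_minr. Qed.

Lemma sparse_degree L w : sparse (link (truncation L)) w ->
  (degree (count_graph L) w <= 4)%N.
Proof.
move=> /andP[d4 /forallP d1]; apply: leq_trans d4.
rewrite [leqRHS](bigD1 w) //= -(big_star _ w (link (truncation L) w)) /=.
apply: leq_trans (leq_addl _ _); apply: leq_sum => e we.
have := d1 (other_end w e); rewrite link_other // val_truncation ffunE.
by case: (count_mem e L) => [|[|]].
Qed.

Lemma sparse_link_adjacent L : (5 <= k)%N ->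
  subrel (sparse_link (link (truncation L))) (Defs.adjacent (run L)).
Proof.
move=> k5 x y /and3P[/sparse_degree dx /sparse_degree dy].
rewrite /link; case E: mkedge => [e|] // e0.
have ee := mkedgeP E; apply/existsP; exists e; rewrite ee eqxx andbT.
rewrite run_eq_count => [|w]; last first.
  rewrite ee !inE => /orP[]/eqP ->; exact: leq_ltn_trans k5.
by rewrite ffunE; move: e0; rewrite val_truncation; case: (count_mem e L).
Qed.

Lemma current_le_Cmax L m : (5 <= k)%N ->
  (#|current (explore (link (truncation L)) m (initial n))| <= Cmax (run L))%N.
Proof.
move=> k5; have es := explored_explore m (linkC (truncation L)).
set s := explore _ _ _ in es *.
have [->|[c cC]] := set_0Vmem (current s); first by rewrite cards0.
apply: leq_trans (leq_bigmax c); apply: subset_leq_card; apply/fintype.subsetP => y yC.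
rewrite inE; have := current_connect es cC yC.
apply: connect_sub => a b ab; apply: connect1; exact: (sparse_link_adjacent k5 ab).
Qed.

End DegreeComparison.

(** * Truncated Poisson counts *)

Section FiniteRange.
Context {d : measure_display} {T : measurableType d} {R : realType}.
Variables (P : probability T R) (I : finType) (X : T -> I).
Hypothesis mX : forall i, measurable [set w | X w = i].

Let finite_rangeE (Q : pred I) :
  [set w | Q (X w)] = \bigcup_(i in [set i | Q i]) [set w | X w = i].
Proof.
by apply/seteqP; split=> [w Qw|w [i Qi /= ->]]; [exists (X w)|exact: Qi].
Qed.

Lemma measurable_finite_range (Q : pred I) : measurable [set w | Q (X w)].
Proof. by rewrite finite_rangeE; apply: fin_bigcup_measurable => //; apply: finite_finset. Qed.

Lemma measure_finite_range (Q : pred I) :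
  P [set w | Q (X w)] = (\sum_(i | Q i) P [set w | X w = i])%E.
Proof.
rewrite finite_rangeE measure_fin_bigcup //; first last.
- by move=> i j _ _ [w [/= <-]].
- exact: finite_finset.
rewrite fsbig_finite /=; last exact: finite_finset.
rewrite -[RHS](big_filter (index_enum I) Q); apply: perm_big.
apply: uniq_perm; rewrite ?fset_uniq ?filter_uniq ?index_enum_uniq // => i.
rewrite in_fset_set; last exact: finite_finset.
by rewrite mem_filter mem_index_enum andbT; apply/idP/idP; rewrite inE.
Qed.

End FiniteRange.

Section PoissonCounts.
Variables (R : realType) (n : nat) (d : measure_display) (T : measurableType d).
Variables (P : probability T R) (X : edge n -> T -> set R) (t : R).

Definition truncate (c : \bar R) : 'I_3 :=
  if c == 0%E then 0 else if c == 1%E then 1 else 2.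

Definition truncated_counts (w : T) : {ffun edge n -> 'I_3} :=
  [ffun e => truncate (npoints (X e) `]0, t] w)].

(** The law of the minimum of 2 and a Poisson variable of mean [r]. *)
Definition poisson3 (r : R) (i : 'I_3) : R :=
  if i == 0 then expR (- r) else if i == 1 then r * expR (- r)
  else 1 - (expR (- r) + r * expR (- r)).

Lemma poisson3_sum r : \sum_i poisson3 r i = 1.
Proof. by rewrite !big_ord_recl big_ord0 /poisson3 /=; ring. Qed.

Lemma poisson3_ge0 r i : 0 <= r -> 0 <= poisson3 r i.
Proof.
move=> r0; rewrite /poisson3; do 2?case: ifP => _; rewrite ?mulr_ge0 ?expR_ge0 //.
rewrite subr_ge0 -[X in X + _]mul1r -mulrDl expRN ler_pdivrMr ?expR_gt0 // mul1r.
exact: expR_ge1Dx.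
Qed.

Hypothesis XP : independent_poisson_processes P (n%:R^-1) X.
Hypothesis t_ge0 : 0 <= t.

Let A : set (measurableTypeR R) := `]0, t].

Let mA : measurable A. Proof. exact: measurable_itv. Qed.

Let cell (i : 'I_3) : set (\bar R) := [set c | truncate c = i].

Let cell0 : cell 0 = [set 0%E].
Proof.
apply/seteqP; split=> c; rewrite /cell /truncate /=; last by move=> ->; rewrite eqxx.
by case: eqP => // _; case: eqP.
Qed.

Let cell1 : cell 1 = [set 1%E].
Proof.
apply/seteqP; split=> c; rewrite /cell /truncate /=.
  by case: eqP => // _; case: eqP.
by move=> ->; rewrite eqxx ifF //; apply/negbTE; rewrite eqe oner_neq0.
Qed.

Let cell2 : cell 2 = ~` (cell 0 `|` cell 1).
Proof.
apply/seteqP; split=> c; rewrite /cell /truncate /=; first by move=> ->; case.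
by case: ifP => [_ []|_]; [left|case: ifP => [_ []|]//; right].
Qed.

Let m_cell i : measurable (cell i).
Proof.
have m0 : measurable (cell 0) by rewrite cell0; apply: emeasurable_set1.
have m1 : measurable (cell 1) by rewrite cell1; apply: emeasurable_set1.
case: i => -[|[|[|//]]] Hi.
- by rewrite (_ : Ordinal _ = 0) //; apply/val_inj.
- by rewrite (_ : Ordinal _ = 1) //; apply/val_inj.
- rewrite (_ : Ordinal _ = 2); last exact/val_inj.
  by rewrite cell2; apply: measurableC; apply: measurableU.
Qed.

Let m_count e i : measurable (npoints (X e) A @^-1` cell i).
Proof.
have [[_ _ /(_ A mA) mf] _ _] := XP.1 e.
by have := mf measurableT _ (m_cell i); rewrite setTI.
Qed.

Let P_count e i : P (npoints (X e) A @^-1` cell i) = (poisson3 (t / n%:R) i)%:E.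
Proof.
have [_ pw _] := XP.1 e.
have At : fine (lebesgue_measure A) = t.
  rewrite lebesgue_measure_itv /= lte_fin; case: ltP => [_|t0] /=.
    by rewrite subr0.
  by apply/eqP; rewrite eq_le t_ge0 t0.
have A_pos : A `<=` `[0, +oo[ by move=> x; rewrite /A /= !in_itv /= andbT => /andP[/ltW].
have A_fin : (lebesgue_measure A < +oo)%E.
  by rewrite lebesgue_measure_itv /=; case: ifP; rewrite ?ltry.
have {}pw m := pw A mA A_pos A_fin m.
have P0 : P (npoints (X e) A @^-1` cell 0) = (poisson3 (t / n%:R) 0)%:E.
  rewrite cell0 (_ : _ @^-1` _ = [set w | npoints (X e) A w = 0%:R%:E]) // pw At.
  by rewrite /poisson_weight /poisson3 expr0 fact0 divr1 mul1r mulrC.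
have P1 : P (npoints (X e) A @^-1` cell 1) = (poisson3 (t / n%:R) 1)%:E.
  rewrite cell1 (_ : _ @^-1` _ = [set w | npoints (X e) A w = 1%:R%:E]) // pw At.
  by rewrite /poisson_weight /poisson3 expr1 divr1 [n%:R^-1 * t]mulrC.
case: i => -[|[|[|//]]] Hi.
- by rewrite (_ : Ordinal _ = 0) //; apply/val_inj.
- by rewrite (_ : Ordinal _ = 1) //; apply/val_inj.
- rewrite (_ : Ordinal _ = 2); last exact/val_inj.
  rewrite cell2 -preimage_setC preimage_setU probability_setC; last exact: measurableU.
  rewrite measureU //.
    by apply: (eq_trans (congr2 (fun a b => 1 - (a + b))%E P0 P1)).
  by rewrite cell0 cell1; apply/seteqP; split=> // w [/= -> /eqP]; rewrite eqe eq_sym oner_eq0.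
Qed.

Let truncated_countsE om : [set w | truncated_counts w = om] =
  \bigcap_e (npoints (X e) A @^-1` cell (om e)).
Proof.
apply/seteqP; split=> [w /= <- e _|w h]; first by rewrite /cell /= ffunE.
by apply/ffunP => e; rewrite ffunE; apply: h.
Qed.

Lemma measurable_truncated_counts om : measurable [set w | truncated_counts w = om].
Proof.
by rewrite truncated_countsE; apply: fin_bigcap_measurable => // ; apply: finite_finset.
Qed.

Lemma truncated_counts_law om :
  P [set w | truncated_counts w = om] = (pweight (poisson3 (t / n%:R)) om)%:E.
Proof.
rewrite truncated_countsE XP.2 => [|e].
  by rewrite /pweight -prodEFin; apply: eq_bigr => e _; apply: P_count.
apply: sub_sigma_algebra; exists A => //.
by exists (cell (om e)) => //; rewrite setTI.
Qed.

End PoissonCounts.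

(** * Measurability of the process *)

Lemma counting_eq0 (T : choiceType) (R : realType) (A : set T) :
  (counting A == 0 :> \bar R)%E = `[< A = set0 >].
Proof.
rewrite /counting; case: asboolP => [finA|infA].
  rewrite eqe pnatr_eq0 cardfs_eq0; apply/eqP/asboolP => [A0|->].
    by rewrite -(fset_setK finA) A0 set_fset0.
  by rewrite fset_set0.
by rewrite [RHS]asboolF // => A0; apply: infA; rewrite A0.
Qed.

Section Chronology.
Variables (R : realType) (n : nat).
Implicit Types (S : edge n -> set R) (x y : R * edge n).

Lemma mark_le_total : total (@mark_le R n).
Proof.
move=> [a e] [b f]; rewrite /mark_le /=; case: ltgtP => //= _.
exact: leq_total.
Qed.

Lemma mark_le_trans : transitive (@mark_le R n).
Proof.
move=> [b f] [a e] [c g]; rewrite /mark_le /=.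
case/orP=> [ab|/andP[/eqP -> ef]] /orP[bc|/andP[/eqP <- fg]].
- by rewrite (lt_trans ab bc).
- by rewrite ab.
- by rewrite bc.
- by rewrite eqxx (leq_trans ef fg) orbT.
Qed.

Lemma mark_le_anti : antisymmetric (@mark_le R n).
Proof.
move=> [a e] [b f]; rewrite /mark_le /=; case: ltgtP => //= -> ef.
by rewrite (enum_rank_inj (ord_inj (anti_leq ef))).
Qed.

Definition chronicle S (t : R) : seq (R * edge n) :=
  sort (@mark_le R n) (fset_set (marks S t)).

Lemma fd_process_run k S t : fd_process k S t = run k [seq x.2 | x <- chronicle S t].
Proof.
by rewrite /fd_process /run -/(chronicle S t); elim: (chronicle S t) (empty_graph n) => /=.
Qed.

Section LocallyFinite.
Variables (S : edge n -> set R) (t : R).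
Hypothesis S_fin : forall e, finite_set (S e `&` `[0, t]).

Lemma finite_marks : finite_set (marks S t).
Proof.
apply: (@sub_finite_set _ _ (\bigcup_(e in [set: edge n])
    (fun a => (a, e)) @` (S e `&` `[0, t]))).
  move=> [a e] [/= /andP[a0 at_] Sa]; exists e => //; exists a => //.
  by split; rewrite //= in_itv /= ltW.
by apply: bigcup_finite => [|e _]; [exact: finite_finset|exact: finite_image].
Qed.

Lemma mem_chronicle x : (x \in chronicle S t) = `[< 0 < x.1 <= t /\ S x.2 x.1 >].
Proof.
rewrite mem_sort in_fset_set; last exact: finite_marks.
by apply/idP/asboolP; rewrite inE.
Qed.

Lemma chronicle_uniq : uniq (chronicle S t).
Proof. by rewrite sort_uniq fset_uniq. Qed.

Lemma counting_chronicle e : counting (S e `&` `]0, t]) =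
  (count_mem e [seq x.2 | x <- chronicle S t])%:R%:E :> \bar R.
Proof.
have fin : finite_set (S e `&` `]0, t]).
  apply: sub_finite_set (S_fin e) => a [Sa]; rewrite /= !in_itv /= => /andP[a0 ->].
  by rewrite ltW.
rewrite /counting asboolT //; congr (_%:R%:E).
rewrite count_map -size_filter -(size_map fst); apply/perm_size/uniq_perm.
- exact: fset_uniq.
- rewrite map_inj_in_uniq ?filter_uniq ?chronicle_uniq // => -[a f] [b g].
  by rewrite !mem_filter /= => /andP[/eqP -> _] /andP[/eqP -> _] ->.
move=> a; rewrite in_fset_set //; apply/idP/mapP; rewrite inE.
  move=> [Sa]; rewrite /= in_itv /= => at_.
  by exists (a, e) => //; rewrite mem_filter /= eqxx mem_chronicle; apply/asboolP.
move=> [[b f]]; rewrite mem_filter /= mem_chronicle => /andP[/eqP -> /asboolP[/= bt Sb] ->].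
by split; rewrite //= in_itv.
Qed.

End LocallyFinite.

(* The grid [x.1 = 0, 1, 2, ...] indexes the slots of length [1 / N.+1]; it
   reuses the type of marks so that both are sorted by the same order. *)
Definition slot (t : R) N (a : R) : set R :=
  `]0, t] `&` `[a / N.+1%:R, (a + 1) / N.+1%:R[.

Definition grid (t : R) N : seq (R * edge n) :=
  sort (@mark_le R n)
    [seq (j%:R, e) | j <- iota 0 (Num.trunc (t * N.+1%:R)).+1, e <- enum {: edge n}].

Definition discrete_edges S (t : R) N : seq (edge n) :=
  [seq x.2 | x <- grid t N & counting (S x.2 `&` slot t N x.1) != 0 :> \bar R].

Lemma mem_grid t N x : reflect
  (exists2 j, (j <= Num.trunc (t * N.+1%:R))%N & x.1 = j%:R) (x \in grid t N).
Proof.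
rewrite mem_sort; apply: (iffP allpairsP) => [[[j e]] [jN _ ->]|[j jN xj]].
  by exists j => //; move: jN; rewrite mem_iota ltnS.
exists (j, x.2); split; first by rewrite mem_iota ltnS.
  by rewrite mem_enum.
by rewrite -xj; case: x {xj}.
Qed.

Lemma grid_uniq t N : uniq (grid t N).
Proof.
rewrite sort_uniq allpairs_uniq ?iota_uniq ?enum_uniq //.
by move=> [i e] [j f] _ _ /= [] /eqP; rewrite eqr_nat => /eqP -> ->.
Qed.

Lemma in_slot t N a (j : nat) : 0 <= a ->
  slot t N j%:R a <-> (0 < a <= t /\ Num.trunc (a * N.+1%:R) = j).
Proof.
move=> a0; have N0 : 0 < N.+1%:R :> R by [].
have aN : 0 <= a * N.+1%:R by rewrite mulr_ge0.
rewrite /slot /= !in_itv /= ler_pdivrMr // ltr_pdivlMr // natr1; split.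
  by move=> [-> /truncn_def].
by move=> [at_ <-]; split=> //; apply: truncn_itv.
Qed.

(** Once the slots are shorter than all gaps between distinct times, marks with distinct times fall
    in distinct slots. Replacing times by slot indices then preserves the order, including the
    tie-breaking of simultaneous marks. *)
Lemma discrete_edges_eq S t : (forall e, finite_set (S e `&` `[0, t])) ->
  exists N0, forall N, (N0 <= N)%N ->
    discrete_edges S t N = [seq x.2 | x <- chronicle S t].
Proof.
move=> S_fin; pose gap x y := Num.trunc ((y.1 - x.1)^-1).
pose L := chronicle S t.
(* The largest integer part of an inverse gap; [N.+1] then exceeds every inverse gap. *)
exists (\max_(x <- L) \max_(y <- L) gap x y)%N => N N_large.
have N0 : 0 < N.+1%:R :> R by [].
have L_pos x : x \in L -> [/\ 0 <= x.1, 0 < x.1, x.1 <= t & S x.2 x.1].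
  by rewrite /L mem_chronicle // => /asboolP[/andP[x0 xt] Sx]; rewrite x0 xt (ltW x0).
have sep x y : x \in L -> y \in L -> x.1 < y.1 ->
    (Num.trunc (x.1 * N.+1%:R) < Num.trunc (y.1 * N.+1%:R))%N.
  move=> xL yL xy; have [x0 _ _ _] := L_pos x xL.
  have gapN : (gap x y <= N)%N.
    apply: leq_trans N_large.
    by apply: leq_trans (leq_bigmax_seq _ xL isT); apply: (leq_bigmax_seq _ yL).
  move: gapN; rewrite truncn_le_nat -[_^-1]mul1r ltr_pdivrMr ?subr_gt0 // mulrC mulrBl => h.
  have /andP[h1 _] := truncn_itv (mulr_ge0 x0 (ltW N0)).
  have : (Num.trunc (x.1 * N.+1%:R)).+1%:R <= y.1 * N.+1%:R.
    by rewrite -natr1; lra.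
  by move=> /le_truncn; rewrite natrK.
pose phi x : R * edge n := ((Num.trunc (x.1 * N.+1%:R))%:R, x.2).
have phi_le : {in L &, {homo phi : x y / mark_le x y}}.
  move=> x y xL yL; rewrite /mark_le /= ltr_nat eqr_nat.
  case/orP => [/(sep x y xL yL) -> //|/andP[/eqP -> ->]].
  by rewrite eqxx orbT.
have phi_inj : {in L &, injective phi}.
  move=> x y xL yL [/eqP]; rewrite eqr_nat => /eqP tr e2.
  suff e1 : x.1 = y.1 by case: x y e1 e2 {xL yL tr} => [a e] [b f] /= -> ->.
  case: (ltgtP x.1 y.1) => // [/(sep x y xL yL)|/(sep y x yL xL)];
    by rewrite tr ltnn.
rewrite /discrete_edges; suff -> : [seq x <- grid t N |
    counting (S x.2 `&` slot t N x.1) != 0 :> \bar R] = [seq phi x | x <- L].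
  by rewrite -map_comp.
apply: (sorted_eq mark_le_trans mark_le_anti).
- exact/(sorted_filter mark_le_trans)/(sort_sorted mark_le_total).
- apply: (homo_sorted_in phi_le); first exact/allP.
  exact: (sort_sorted mark_le_total).
apply: uniq_perm; first by rewrite filter_uniq ?grid_uniq.
  by rewrite map_inj_in_uniq // chronicle_uniq.
move=> z; rewrite mem_filter counting_eq0; apply/andP/mapP.
  move=> [/asboolPn/eqP/set0P[a [Sa az]] /mem_grid[j jt zj]].
  have a0 : 0 <= a by case: az; rewrite /= in_itv /= => /andP[/ltW].
  move: az; rewrite zj => /(in_slot _ _ _ a0)[at_ aj].
  exists (a, z.2); first by rewrite mem_chronicle //; apply/asboolP.
  by rewrite /phi /= aj -zj; case: (z).
move=> [x xL ->]; have [x0 xp xt Sx] := L_pos x xL; split.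
  apply/asboolPn/eqP/set0P; exists x.1; split=> //=.
  by apply/(in_slot _ _ _ x0); rewrite xp xt.
apply/mem_grid; exists (Num.trunc (x.1 * N.+1%:R)) => //=.
by apply: le_truncn; rewrite ler_pM2r.
Qed.

End Chronology.

Section Measurability.
Variables (R : realType) (n k : nat) (d : measure_display) (T : measurableType d).
Variables (X : edge n -> T -> set R) (t : R).
Hypothesis XP : forall e, point_process (X e).

Lemma truncated_counts_chronicle w :
  truncated_counts X t w = truncation [seq x.2 | x <- chronicle (X^~ w) t].
Proof.
apply/ffunP => e; rewrite !ffunE /npoints.
have -> := @counting_chronicle _ _ (X^~ w) t _ e; last first.
  by move=> f; have [_ + _] := XP f; apply.
apply/val_inj => /=; rewrite /truncate !eqe pnatr_eq0 -[1]/(1%:R) eqr_nat.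
by rewrite inordK ?ltnS ?geq_minr //; case: count => [|[|]].
Qed.

Let mslot N a : @measurable _ (measurableTypeR R) (slot t N a).
Proof. by apply: measurableI; apply: measurable_itv. Qed.

(** The list is a function of finitely many bits, one per slot and edge, telling whether the slot
    contains a point. *)
Let measurable_discrete N (Q : pred (seq (edge n))) :
  measurable [set w | Q (discrete_edges (X^~ w) t N)].
Proof.
pose g := in_tuple (grid n t N).
pose bit (x : R * edge n) w := (npoints (X x.2) (slot t N x.1) w != 0)%E.
have -> : [set w | Q (discrete_edges (X^~ w) t N)] =
    [set w | Q [seq x.2 | x <- mask (map_tuple (bit^~ w) g) (grid n t N)]].
  by apply/seteqP; split=> w /=; rewrite /discrete_edges filter_mask.
pose Q' (b : (size (grid n t N)).-tuple bool) := Q [seq x.2 | x <- mask b (grid n t N)].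
apply: (@measurable_finite_range _ _ _ (fun w => map_tuple (bit^~ w) g) _ Q') => b.
have -> : [set w | map_tuple (bit^~ w) g = b] =
    \bigcap_i [set w | bit (tnth g i) w = tnth b i].
  apply/seteqP; split=> [w /= <- i _|w h] /=; first by rewrite tnth_map.
  by apply/eq_from_tnth => i; rewrite tnth_map; apply: h.
apply: fin_bigcap_measurable; first exact: finite_finset.
move=> i _; have [_ _ /(_ _ (mslot N (tnth g i).1)) mf] := XP (tnth g i).2.
pose c := npoints (X (tnth g i).2) (slot t N (tnth g i).1).
have m0 : measurable (c @^-1` [set 0%E]).
  by have := mf measurableT _ (emeasurable_set1 0%E); rewrite setTI.
case: (tnth b i).
  rewrite (_ : [set _ | _] = ~` (c @^-1` [set 0%E])).
    exact: measurableC.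
  by apply/seteqP; split=> w /=; rewrite /bit /c; [move/eqP|move=> h; apply/eqP].
rewrite (_ : [set _ | _] = c @^-1` [set 0%E]) //.
by apply/seteqP; split=> w /=; rewrite /bit /c; [move/negbFE/eqP|move=> ->; rewrite eqxx].
Qed.

(** The event is the lower limit, as [N] grows, of its discretised versions, since at each sample
    point these are eventually exact. *)
Lemma measurable_fd_process (Q : pred (multigraph n)) :
  measurable [set w | Q (fd_process k (X^~ w) t)].
Proof.
rewrite (_ : [set _ | _] = \bigcup_N0 \bigcap_(N in [set N | N0 <= N]%N)
    [set w | Q (run k (discrete_edges (X^~ w) t N))]).
  apply: bigcupT_measurable => N0; apply: bigcap_measurable.
    by exists N0 => /=.
  by move=> N _; apply: (measurable_discrete N (fun L => Q (run k L))).
have disc w : exists N0, forall N, (N0 <= N)%N ->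
    discrete_edges (X^~ w) t N = [seq x.2 | x <- chronicle (X^~ w) t].
  by apply: discrete_edges_eq => e; have [_ + _] := XP e; apply.
apply/seteqP; split=> w /=; rewrite fd_process_run; have [N0 N0P] := disc w.
  by move=> Qw; exists N0 => // N /= NN0; rewrite N0P.
move=> [N1 _ h]; have := h (maxn N0 N1) (leq_maxr _ _).
by rewrite /= N0P ?leq_maxl.
Qed.

End Measurability.

(** * The giant component *)

(** Start from [exp(-1/32) >= 31/32] and square six times, rounding down. *)
Lemma expRN2_ge (R : realType) : 13 / 100 <= expR (- 2 : R).
Proof.
pose u : R := expR (- (1 / 32)).
have u0 a : 0 <= u ^+ a by rewrite exprn_ge0 ?expR_ge0.
have square (a : nat) (b c : R) : 0 <= b -> c <= b * b -> b <= u ^+ a -> c <= u ^+ (a * 2).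
  by move=> b0 cb h; apply: le_trans cb _; rewrite exprM expr2 ler_pM.
have -> : expR (- 2 : R) = u ^+ 64.
  by rewrite -expRM_natl; congr expR; field.
have u1 : 31 / 32 <= u ^+ 1.
  by rewrite expr1 /u; apply: le_trans (expR_ge1Dx _); lra.
have u2 : 9384 / 10000 <= u ^+ 2 by apply: square u1; clear; lra.
have u4 : 8805 / 10000 <= u ^+ 4 by apply: square u2; clear; lra.
have u8 : 7752 / 10000 <= u ^+ 8 by apply: square u4; clear; lra.
have u16 : 6009 / 10000 <= u ^+ 16 by apply: square u8; clear; lra.
have u32 : 3610 / 10000 <= u ^+ 32 by apply: square u16; clear; lra.
by apply: square u32; clear; lra.
Qed.

Lemma fd_process_giant (R : realType) (k n : nat) (d : measure_display)
    (T : measurableType d) (P : probability T R) (X : edge n -> T -> set R) (t : R)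
    (q : nat) :
  (5 <= k)%N -> (1000 <= n)%N -> (1000 * (20 * q) <= n)%N ->
  199 / 100 <= t <= 2 -> independent_poisson_processes P n%:R^-1 X ->
  ((1 - 2 * (9 / 10) ^+ q)%:E <=
   P [set w | (q < 3 * Cmax (fd_process k (X^~ w) t))%N])%E.
Proof.
move=> k5 n1000 qn /andP[t_ge t_le] XP.
have n0 : (0 < n)%N by apply: leq_trans n1000.
have nR : 0 < n%:R :> R by rewrite ltr0n.
have t0 : 0 <= t by apply: le_trans t_ge; lra.
pose x : R := t / n%:R; have nx : n%:R * x = t by rewrite /x mulrC divfK // gt_eqF.
have x0 : 0 <= x by rewrite divr_ge0 // ltW.
pose p := poisson3 x.
have p0 : p ord0 = expR (- x) by [].
have p_ge0 i : 0 <= p i by apply: poisson3_ge0.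
have p_sum : \sum_i p i = 1 by apply: poisson3_sum.
have et : 13 / 100 <= expR (- t).
  by apply: le_trans (expRN2_ge R) _; rewrite ler_expR lerN2.
have p0n : p ord0 ^+ n = expR (- t) by rewrite p0 -expRM_natl mulrN nx.
have := @expect_small_exploration R n p x p_ge0 p_sum.
have p1 : p 1 = x * p ord0 by [].
have p0x : 1 - x <= p ord0 by rewrite p0; apply: expR_ge1Dx.
have p0n' : 13 / 100 <= p ord0 ^+ n by rewrite p0n.
have xn : 199 / 100 <= n%:R * x <= 2 by rewrite nx t_ge.
have x9 : (1 + x) ^+ n <= 9.
  apply: (@le_trans _ _ (expR x ^+ n)).
    by rewrite lerXn2r ?nnegrE ?addr_ge0 ?expR_ge0 // expR_ge1Dx.
  (* [exp(t)] is the inverse of [exp(-t)], hence at most [100 / 13 < 9]. *)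
  rewrite -expRM_natl nx; have := expRxMexpNx_1 t; have := expR_gt0 t.
  by move: et; move: (expR (- t)) (expR t) => a b; nra.
move=> /(_ p1 p0x p0n' xn x9 n1000 q qn) small.
pose Q (om : {ffun edge n -> 'I_3}) :=
  (q < 3 * #|current (explore (link om) (20 * q) (initial n))|)%N.
have mX := measurable_truncated_counts t XP.
have XPP e : point_process (X e) by have [] := XP.1 e.
(* The truncated counts have the product law, so the bound on the finite product transfers to [P];
   then [Q] forces a large component of the process. *)
apply: (@le_trans _ _ (P [set w | Q (truncated_counts X t w)])).
  rewrite (measure_finite_range P mX Q).
  rewrite (eq_bigr (fun om => (pweight p om)%:E)); last first.
    by move=> om _; apply: truncated_counts_law.
  rewrite sumEFin lee_fin lerBlDr -lerBlDl.
  apply: le_trans small; rewrite lerBlDr.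
  have {1}-> : 1 = expect p (fun om : {ffun edge n -> 'I_3} => 1) by rewrite expect_cst.
  rewrite /expect [X in _ <= _ + X]big_mkcond -big_split /=; apply: ler_sum => om _.
  rewrite /Q; case: leqP => _; first by rewrite addr0.
  by rewrite mulr0 add0r mulr1.
apply: le_measure; rewrite ?inE.
- exact: measurable_finite_range.
- exact: (measurable_fd_process k t XPP (fun G => q < 3 * Cmax G)%N).
move=> w; rewrite /Q /= (truncated_counts_chronicle t XPP) fd_process_run.
by move=> /leq_trans; apply; rewrite leq_mul2l current_le_Cmax.
Qed.

Theorem theorem1p2 (R : realType) (k : nat) (hk : (5 <= k)%N) :
  exists I : set R,
    [/\ is_interval I, I `<=` `[0, +oo[, (0 < lebesgue_measure I)%E &
      forall t : R, I t -> exists2 alpha : R, 0 < alpha &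
        forall (d : nat -> measure_display)
               (T : forall n : nat, measurableType (d n))
               (P : forall n : nat, probability (T n) R)
               (Pi : forall n : nat, edge n -> T n -> set R),
          (forall n : nat, (0 < n)%N ->
             independent_poisson_processes (P n) (n%:R^-1) (Pi n)) ->
          P n [set w : T n | alpha * n%:R <=
                 (Cmax (fd_process k (fun e => Pi n e w) t))%:R]
            @[n --> \oo] --> 1%E].
Proof.
exists `[199 / 100, 2]%classic; split.
- exact: interval_is_interval.
- by move=> t; rewrite /= !in_itv /= andbT => /andP[h _]; apply: le_trans h; lra.
- by rewrite lebesgue_measure_itv /= lte_fin ifT ?lte_fin; lra.
move=> t; rewrite /= in_itv /= => tI.
(* From [n < 20000 * (q + 1)] and [q + 1 <= 3 * Cmax] follows [n <= 60000 * Cmax]. *)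
exists (60 * 1000)^-1; first by rewrite invr_gt0; lra.
(* The largest [q] with [1000 * (20 * q) <= n]. *)
move=> d T P Pi PiP; pose q n := (n %/ 1000 %/ 20)%N.
have q_oo : q n @[n --> \oo] --> \oo.
  apply/cvgnyPge => A; exists (1000 * (20 * A))%N => // n /= An.
  by rewrite /q !leq_divRL // mulnC [(_ * 20)%N]mulnC.
have lim1 : ((1 - 2 * (9 / 10) ^+ q n)%:E : \bar R) @[n --> \oo] --> 1%E.
  apply: cvg_EFin; first by apply: nearW => m; rewrite fin_numE.
  have -> : 1 = 1 - 2 * 0 :> R by rewrite mulr0 subr0.
  rewrite [X in X @ _](_ : _ = fun m => 1 - 2 * (9 / 10) ^+ q m); last first.
    by apply/funext => m /=; rewrite mulr0 subr0.
  apply: cvgB; first exact: cvg_cst.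
  have z1 : `|9 / 10 : R| < 1 by rewrite ger0_norm; lra.
  by apply: cvgMr; apply: (cvg_comp _ _ q_oo (cvg_expr z1)).
apply: (squeeze_cvge _ lim1 (cvg_cst 1%E)).
near=> n.
have n1000 : (1000 <= n)%N by near: n; apply: nbhs_infty_ge.
have n0 : (0 < n)%N by apply: leq_trans n1000.
have q_le : (1000 * (20 * q n) <= n)%N.
  rewrite (leq_trans _ (leq_trunc_div n 1000)) // mulnC leq_mul2r /=.
  by rewrite mulnC leq_trunc_div.
have XPP e : point_process (Pi n e) by have [] := (PiP n n0).1 e.
set E := [set w | _]; have mE : measurable E.
  exact: (measurable_fd_process k t XPP (fun G => (60 * 1000)^-1 * n%:R <= (Cmax G)%:R :> R)).
rewrite probability_le1 // andbT.
apply: le_trans (fd_process_giant hk n1000 q_le tI (PiP n n0)) _.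
apply: le_measure; rewrite ?inE //.
  exact: (measurable_fd_process k t XPP (fun G => q n < 3 * Cmax G)%N).
move=> w; rewrite /E /=; set C := Cmax _ => qC.
rewrite ler_pdivrMl; last lra.
have n_lt : (n < 1000 * (20 * (q n).+1))%N.
  have h1 := ltn_ceil n (isT : (0 < 1000)%N).
  have h2 := ltn_ceil (n %/ 1000) (isT : (0 < 20)%N).
  move: h1 h2; rewrite /q; move: (n %/ 1000 %/ 20)%N (n %/ 1000)%N => b a.
  by clear -a b; lia.
have : (n <= 60 * 1000 * C)%N.
  by move: (q n) n_lt qC => b; clear -b C; lia.
by rewrite -(ler_nat R) !natrM.
Unshelve. all: by end_near.
Qed.
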